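(* Let $\mathcal D$ be a commutative variety of ordered algebras, let $X,Y\in\mathcal D$ and let $L:X^*\to Y$ be a language. Define the relation $\le_L$ on $|X^*|$ by $u\le_L v$ iff $L(x\bullet u\bullet y)\le L(x\bullet v\bullet y)$ for all $x,y\in|X^*|$. Then $\le_L$ is a congruence of the free $\mathcal D$-monoid $X^*$ (a preorder containing the order of $X^*$, forming a subalgebra of $X^*\times X^*$, with respect to which the multiplication is monotone), and the quotient map $X^*\to X^*/{\le_L}$ is the syntactic $\mathcal D$-monoid of $L$, i.e. $\mathrm{Syn}(L)=X^*/{\le_L}$.
   Context: Ordered $\Sigma$-algebras are posets with monotone $\Sigma$-operations; morphisms are monotone homomorphisms. A commutative variety of ordered algebras $\mathcal D$ is a class of ordered $\Sigma$-algebras ($\Sigma$ finitary) specified by inequations, such that for all $A,B$ the poset $[A,B]$ of homomorphisms (pointwise order) is a subalgebra of $B^{|A|}$. Its tensor product represents bimorphisms (maps $|A|\times|B|\to|C|$ that are morphisms in each variable); $I$ is the free algebra on one generator. A $\mathcal D$-monoid is an object $M$ with a monoid structure $(|M|,\bullet,1)$ whose multiplication is a bimorphism; morphisms preserve $\bullet,1$. $X^*$ is the free $\mathcal D$-monoid on $X$; a language is a morphism $L:X^*\to Y$. For a congruence $\preccurlyeq$ on an ordered algebra $A$, the quotient $A/{\preccurlyeq}$ is $A$ modulo the equivalence $\preccurlyeq\cap\succcurlyeq$, ordered by $[u]\le[v]$ iff $u\preccurlyeq v$. A $\mathcal D$-monoid morphism $e:X^*\to M$ recognizes $L$ if $L=f\circ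 e$ for some morphism $f:M\to Y$. An $X$-generated $\mathcal D$-monoid is a surjective $\mathcal D$-monoid morphism $e:X^*\to M$; $e_1\le e_2$ iff $e_1=h\circ e_2$ for a $\mathcal D$-monoid morphism $h$. The syntactic $\mathcal D$-monoid is the (unique up to iso) $X$-generated $\mathcal D$-monoid recognizing $L$ that is $\le$ every $X$-generated $\mathcal D$-monoid recognizing $L$. *)

(* Defs.v *)
From HB Require Import structures.
From mathcomp Require Import all_boot all_order.
From mathcomp Require Import mathcomp_extra boolp.

Set Implicit Arguments.
Unset Strict Implicit.
Unset Printing Implicit Defensive.

Import Order.TTheory.
Local Open Scope order_scope.
Local Open Scope quotient_scope.

Record signature := Signature { symbol :> Type; arity : symbol -> nat }.

Definition ops (S : signature) (T : Type) : Type :=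
  forall s : S, ('I_(arity s) -> T) -> T.

(* The display of a porderType only drives notations, so fixing one loses no
   generality. *)
Record ordAlg (S : signature) := OrdAlg {
  alg_sort :> porderType Order.default_display;
  op : ops S alg_sort;
  op_mono : forall (s : S) (x y : 'I_(arity s) -> alg_sort),
    (forall i, x i <= y i) -> op x <= op y }.

Definition is_morphism (S : signature) (A B : ordAlg S) (f : A -> B) : Prop :=
  {homo f : x y / x <= y} /\
  (forall (s : S) (x : 'I_(arity s) -> A), f (op x) = op (fun i => f (x i))).

Definition is_subalgebra (S : signature) (T : Type) (o : ops S T)
    (P : T -> Prop) : Prop :=
  forall (s : S) (x : 'I_(arity s) -> T), (forall i, P (x i)) -> P (o s x).

Definition pow_op (S : signature) (T : Type) (B : ordAlg S) : ops S (T -> B) :=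
  fun s f t => op (fun i => f i t).

Definition prod_op (S : signature) (A B : ordAlg S) : ops S (A * B) :=
  fun s x => (op (fun i => (x i).1), op (fun i => (x i).2)).

Inductive term (S : signature) : Type :=
  | Var of nat
  | App (s : S) of ('I_(arity s) -> term S).

Fixpoint eval (S : signature) (A : ordAlg S) (v : nat -> A) (t : term S) : A :=
  match t with
  | Var n => v n
  | App s a => op (fun i => eval v (a i))
  end.

(* [inequation t u] means that the inequation t <= u belongs to the axioms.
   As operations are finitary, countably many variables suffice. *)
Record variety := Variety {
  sig : signature;
  inequation : term sig -> term sig -> Prop }.

Definition satisfies (D : variety) (A : ordAlg (sig D)) : Prop :=
  forall t u : term (sig D), inequation t u ->
    forall v : nat -> A, eval v t <= eval v u.

Record object (D : variety) := Object {
  obj_alg :> ordAlg (sig D);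
  objP : satisfies obj_alg }.

Definition commutative_variety (D : variety) : Prop :=
  forall A B : object D, is_subalgebra (@pow_op _ A B) (@is_morphism _ A B).

Definition is_bimorphism (S : signature) (A B C : ordAlg S) (f : A -> B -> C)
    : Prop :=
  (forall a : A, is_morphism (f a)) /\
  (forall b : B, is_morphism (fun a : A => f a b)).

Record dmonoid (D : variety) := DMonoid {
  dm_obj :> object D;
  dm_one : dm_obj;
  dm_mul : dm_obj -> dm_obj -> dm_obj;
  dm_mulA : associative dm_mul;
  dm_mul1m : left_id dm_one dm_mul;
  dm_mulm1 : right_id dm_one dm_mul;
  dm_bimorphism : is_bimorphism dm_mul }.

Arguments dm_one {D}.

Notation "x • y" := (dm_mul x y) (at level 40, left associativity).

Definition is_dmonoid_morphism (D : variety) (M N : dmonoid D) (h : M -> N)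
    : Prop :=
  [/\ is_morphism h, h (dm_one M) = dm_one N & {morph h : x y / x • y}].

(* [XS], with the universal morphism [eta], is the free D-monoid X^* on X. *)
Definition is_free_dmonoid (D : variety) (X : object D) (XS : dmonoid D)
    (eta : X -> XS) : Prop :=
  is_morphism eta /\
  (forall (M : dmonoid D) (g : X -> M), is_morphism g ->
     exists! h : XS -> M, is_dmonoid_morphism h /\ h \o eta = g).

Definition is_congruence (S : signature) (A : ordAlg S) (R : A -> A -> Prop)
    : Prop :=
  [/\ forall u, R u u,
      forall u v w, R u v -> R v w -> R u w,
      forall u v, u <= v -> R u v
    & is_subalgebra (@prod_op _ A A) (fun p => R p.1 p.2)].

Definition is_dmonoid_congruence (D : variety) (M : dmonoid D)
    (R : M -> M -> Prop) : Prop :=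
  is_congruence R /\
  (forall u u' v v', R u u' -> R v v' -> R (u • v) (u' • v')).

Definition congr_rel (S : signature) (A : ordAlg S) (R : A -> A -> Prop) : rel A :=
  fun u v => `[< R u v /\ R v u >].

Lemma congr_equivP (S : signature) (A : ordAlg S) (R : A -> A -> Prop)
  (cR : is_congruence R) : equiv_class_of (congr_rel R).
Proof.
case: cR => Rxx Rtr _ _; split=> [u|u v|v u w].
- by apply/asboolP.
- by apply: asbool_equiv_eq; split=> -[].
- move=> /asboolP[uv vu] /asboolP[vw wv]; apply/asboolP.
  by split; [apply: Rtr vw | apply: Rtr vu].
Qed.

Definition congr_equiv (S : signature) (A : ordAlg S) (R : A -> A -> Prop)
  (cR : is_congruence R) : equiv_rel A := EquivRelPack (congr_equivP cR).

Section Quotient.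
Context (S : signature) (A : ordAlg S) (R : A -> A -> Prop).
Context (cR : is_congruence R).

Definition quot : Type := {eq_quot congr_equiv cR}.
HB.instance Definition _ := Choice.on quot.
HB.instance Definition _ := EqQuotient.on quot.
Local Notation Q := quot.

Definition quot_map (u : A) : Q := \pi_Q u.

Definition quot_le : rel Q := fun a b => `[< R (repr a) (repr b) >].

Lemma quot_mapK (a : Q) : quot_map (repr a) = a.
Proof. exact: reprK. Qed.

Lemma repr_quot_map (u : A) : R (repr (quot_map u)) u /\ R u (repr (quot_map u)).
Proof.
have /eqmodP/asboolP : quot_map (repr (quot_map u)) = quot_map u by exact: reprK.
by [].
Qed.

Lemma quot_le_refl : reflexive quot_le.
Proof. by move=> a; apply/asboolP; case: cR. Qed.

Lemma quot_le_anti : antisymmetric quot_le.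
Proof.
move=> a b /andP[/asboolP ab /asboolP ba].
by rewrite -(quot_mapK a) -(quot_mapK b); apply/eqmodP/asboolP.
Qed.

Lemma quot_le_trans : transitive quot_le.
Proof.
move=> b a c /asboolP ab /asboolP bc; apply/asboolP.
by case: cR => _ Rtr _ _; apply: Rtr bc.
Qed.

HB.instance Definition _ := Order.Le_isPOrder.Build Order.default_display Q
  quot_le_refl quot_le_anti quot_le_trans.

Lemma quot_mapP (u v : A) : quot_map u <= quot_map v <-> R u v.
Proof.
case: cR => _ Rtr _ _.
have [ru ur] := repr_quot_map u; have [rv vr] := repr_quot_map v.
split=> [/asboolP uv|uv]; first exact: Rtr ur (Rtr _ _ _ uv rv).
by apply/asboolP; apply: Rtr ru (Rtr _ _ _ uv vr).
Qed.

Definition quot_op : ops S Q := fun s a => quot_map (op (fun i => repr (a i))).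

Lemma R_op (s : S) (x y : 'I_(arity s) -> A) :
  (forall i, R (x i) (y i)) -> R (op x) (op y).
Proof.
by case: cR => _ _ _ Rop xy; exact: (Rop s (fun i => (x i, y i))).
Qed.

Lemma quot_op_mono (s : S) (a b : 'I_(arity s) -> Q) :
  (forall i, a i <= b i) -> quot_op a <= quot_op b.
Proof.
by move=> ab; apply/quot_mapP/R_op => i; apply/quot_mapP; rewrite !quot_mapK.
Qed.

Definition quot_alg : ordAlg S := OrdAlg quot_op_mono.

Lemma quot_map_morphism : is_morphism (quot_map : A -> quot_alg).
Proof.
split=> [u v uv|s x]; first by apply/quot_mapP; case: cR => _ _ + _; apply.
by apply: le_anti; apply/andP; split; apply/quot_mapP/R_op => i;
  case: (repr_quot_map (x i)).
Qed.

End Quotient.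

Lemma eval_morphism (S : signature) (A B : ordAlg S) (f : A -> B)
    (v : nat -> A) (t : term S) :
  is_morphism f -> f (eval v t) = eval (f \o v) t.
Proof.
case=> _ fop; elim: t => [//|s a IH] /=; rewrite fop.
by congr (op _); apply: funext.
Qed.

Lemma quot_satisfies (D : variety) (A : object D) (R : A -> A -> Prop)
  (cR : is_congruence R) : satisfies (quot_alg cR).
Proof.
move=> t u tu v; have qm := quot_map_morphism cR.
have -> : v = (quot_map cR : A -> quot_alg cR) \o (fun n => repr (v n)).
  by apply: funext => n /=; rewrite quot_mapK.
by rewrite -!(eval_morphism _ _ qm); apply: qm.1; exact: objP.
Qed.

Definition quot_obj (D : variety) (A : object D) (R : A -> A -> Prop)
  (cR : is_congruence R) : object D := Object (@quot_satisfies D A R cR).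

Section QuotientMonoid.
Context (D : variety) (M : dmonoid D) (R : M -> M -> Prop).
Context (cR : is_dmonoid_congruence R).
Local Notation Q := (quot_obj cR.1).

Definition quot_proj : M -> Q := quot_map cR.1.

Definition quot_mul (a b : Q) : Q :=
  quot_proj ((repr (a : quot cR.1)) • (repr (b : quot cR.1))).

Lemma quot_projS (a : Q) : exists u, a = quot_proj u.
Proof. by exists (repr (a : quot cR.1)); rewrite /quot_proj quot_mapK. Qed.

Lemma quot_projM (u v : M) : quot_mul (quot_proj u) (quot_proj v) = quot_proj (u • v).
Proof.
have [ru ur] := repr_quot_map cR.1 u; have [rv vr] := repr_quot_map cR.1 v.
by apply: le_anti; apply/andP; split; apply/quot_mapP; apply: cR.2.
Qed.

Lemma quot_mulA : associative quot_mul.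
Proof.
move=> a b c; have [u ->] := quot_projS a; have [v ->] := quot_projS b.
by have [w ->] := quot_projS c; rewrite !quot_projM dm_mulA.
Qed.

Lemma quot_mul1m : left_id (quot_proj (dm_one M)) quot_mul.
Proof. by move=> a; have [u ->] := quot_projS a; rewrite quot_projM dm_mul1m. Qed.

Lemma quot_mulm1 : right_id (quot_proj (dm_one M)) quot_mul.
Proof. by move=> a; have [u ->] := quot_projS a; rewrite quot_projM dm_mulm1. Qed.

Lemma quot_proj_op (s : sig D) (x : 'I_(arity s) -> M) :
  quot_proj (op x) = op (fun i => quot_proj (x i)).
Proof. exact: (quot_map_morphism cR.1).2. Qed.

Lemma quot_lift (s : sig D) (x : 'I_(arity s) -> Q) :
  x = fun i => quot_proj (repr (x i : quot cR.1)).
Proof. by apply: funext => i; rewrite /quot_proj quot_mapK. Qed.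

Lemma quot_bimorphism : is_bimorphism quot_mul.
Proof.
have [mr ml] := dm_bimorphism M; have [[Rxx _ _ _] Rmul] := cR.
split=> c; have [w ->] := quot_projS c; split=> [a b|s x].
- have [u ->] := quot_projS a; have [v ->] := quot_projS b.
  by rewrite !quot_projM => /quot_mapP uv; apply/quot_mapP/Rmul.
- rewrite (quot_lift x) -quot_proj_op quot_projM (mr w).2 quot_proj_op.
  by congr (op _); apply: funext => i; rewrite quot_projM.
- have [u ->] := quot_projS a; have [v ->] := quot_projS b.
  by rewrite !quot_projM => /quot_mapP uv; apply/quot_mapP/Rmul.
- rewrite (quot_lift x) -quot_proj_op quot_projM (ml w).2 quot_proj_op.
  by congr (op _); apply: funext => i; rewrite quot_projM.
Qed.

Definition quot_dmonoid : dmonoid D :=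
  DMonoid quot_mulA quot_mul1m quot_mulm1 quot_bimorphism.

Definition quot_dmonoid_map : M -> quot_dmonoid := quot_proj.

End QuotientMonoid.

Definition recognizes (D : variety) (XS M : dmonoid D) (Y : object D)
    (e : XS -> M) (L : XS -> Y) : Prop :=
  exists f : M -> Y, is_morphism f /\ L = f \o e.

Definition is_generated (D : variety) (XS M : dmonoid D) (e : XS -> M) : Prop :=
  is_dmonoid_morphism e /\ (forall m : M, exists w : XS, e w = m).

Definition generated_le (D : variety) (XS M1 M2 : dmonoid D)
    (e1 : XS -> M1) (e2 : XS -> M2) : Prop :=
  exists h : M2 -> M1, is_dmonoid_morphism h /\ e1 = h \o e2.

Definition generated_iso (D : variety) (XS M1 M2 : dmonoid D)
    (e1 : XS -> M1) (e2 : XS -> M2) : Prop :=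
  exists (h : M2 -> M1) (g : M1 -> M2),
    [/\ is_dmonoid_morphism h, is_dmonoid_morphism g, cancel h g, cancel g h
      & e1 = h \o e2].

Definition is_syntactic (D : variety) (XS : dmonoid D) (Y : object D)
    (L : XS -> Y) (M : dmonoid D) (e : XS -> M) : Prop :=
  [/\ is_generated e, recognizes e L
    & forall (M' : dmonoid D) (e' : XS -> M'),
        is_generated e' -> recognizes e' L -> generated_le e e'].

Definition syntactic_le (D : variety) (XS : dmonoid D) (Y : object D)
    (L : XS -> Y) (u v : XS) : Prop :=
  forall x y : XS, L (x • u • y) <= L (x • v • y).

(* Main.v *)
Require Import Defs.
From mathcomp Require Import all_boot all_order.
From mathcomp Require Import boolp.

Set Implicit Arguments.
Unset Strict Implicit.
Unset Printing Implicit Defensive.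

Import Order.TTheory.
Local Open Scope order_scope.

(* A surjective morphism e has the homomorphism property: any morphism g that is
   monotone for the preorder [e u <= e v] factors through e. If L = f \o e with
   e a surjective monoid morphism, then [e u <= e v] implies
   [L (x u y) = f (e x e u e y) <= f (e x e v e y) = L (x v y)], so the preorder
   of e is contained in <=_L and the quotient by <=_L factors through e.
   Conversely, taking x = y = 1 shows that L itself factors through the quotient
   by <=_L. *)

Lemma homomorphism_factor (S : signature) (A B C : ordAlg S)
    (e : A -> B) (g : A -> C) :
  is_morphism e -> (forall b, exists a, e a = b) -> is_morphism g ->
  (forall u v, e u <= e v -> g u <= g v) ->
  exists h : B -> C, is_morphism h /\ g = h \o e.
Proof.
move=> [_ eop] es [_ gop] eg.
(* The section [s] need not be a morphism. Since [e (s (e u)) = e u], the hypothesis on [g] applies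
   in both directions, so antisymmetry makes [g \o s] independent of the chosen preimage. *)
have [s sK] := choice es.
have gs u : g (s (e u)) = g u.
  by apply: le_anti; rewrite !eg ?sK.
exists (g \o s); split; last by apply: funext => u /=.
split=> [a b ab|o x] /=; first by apply: eg; rewrite !sK.
(* Applying the operation in [A] to the chosen preimages gives another preimage of [op x], on which
   [g] takes the same value by [gs]. *)
rewrite -gop -(gs (op _)) eop; congr (g (s (op _))).
by apply: funext => i; rewrite sK.
Qed.

(** Elements of [N] lift along the surjection [e], so the factor inherits unit and multiplication
    from [g]. *)
Lemma dmonoid_homomorphism_factor (D : variety) (M N P : dmonoid D)
    (e : M -> N) (g : M -> P) :
  is_generated e -> is_dmonoid_morphism g ->
  (forall u v, e u <= e v -> g u <= g v) ->
  exists h : N -> P, is_dmonoid_morphism h /\ g = h \o e.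
Proof.
move=> [[me e1 eM] es] [mg g1 gM] /(homomorphism_factor me es mg)[h [mh gE]].
have hE u : h (e u) = g u by rewrite gE.
exists h; split=> //; split=> // [|a b]; first by rewrite -e1 hE.
by have [u <-] := es a; have [v <-] := es b; rewrite -eM !hE.
Qed.

(** The composites of the two comparison maps fix the images of [e1] and [e2], which are everything
    by surjectivity. *)
Lemma generated_le_antisym (D : variety) (XS M N : dmonoid D)
    (e1 : XS -> M) (e2 : XS -> N) :
  is_generated e1 -> is_generated e2 ->
  generated_le e1 e2 -> generated_le e2 e1 -> generated_iso e1 e2.
Proof.
move=> [_ s1] [_ s2] [h [mh hE]] [g [mg gE]].
have he u : h (e2 u) = e1 u by rewrite hE.
have ge u : g (e1 u) = e2 u by rewrite gE.
exists h, g; split=> // a.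
- by have [u <-] := s2 a; rewrite he ge.
- by have [u <-] := s1 a; rewrite ge he.
Qed.

Lemma syntactic_unique (D : variety) (XS M N : dmonoid D) (Y : object D)
    (L : XS -> Y) (e1 : XS -> M) (e2 : XS -> N) :
  is_syntactic L e1 -> is_syntactic L e2 -> generated_iso e1 e2.
Proof.
move=> [g1 r1 m1] [g2 r2 m2].
by apply: generated_le_antisym => //; [apply: m1|apply: m2].
Qed.

(** A context is a left translation followed by a right one, both morphisms as multiplication is a
    bimorphism. *)
Lemma mul_context_morphism (D : variety) (M : dmonoid D) (x y : M) :
  is_morphism (fun u : M => x • u • y).
Proof.
have [mr ml] := dm_bimorphism M.
split=> [u v uv|s u]; first by apply: (ml y).1; apply: (mr x).1.
by rewrite (mr x).2 (ml y).2.
Qed.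

Lemma syntactic_le_congruence (D : variety) (M : dmonoid D) (Y : object D)
    (L : M -> Y) :
  is_morphism L -> is_dmonoid_congruence (syntactic_le L).
Proof.
move=> [Lmono Lop]; split; first split.
- by move=> u x y.
- by move=> u v w uv vw x y; apply: le_trans (uv x y) (vw x y).
- by move=> u v uv x y; apply: Lmono; apply: (mul_context_morphism x y).1.
- move=> s p Rp x y /=.
  rewrite !(mul_context_morphism x y).2 !Lop.
  by apply: op_mono => i; apply: Rp.
- move=> u u' v v' uu' vv' x y.
  (* Transitivity through [x • u' • v • y]: the neighbouring factor is absorbed into the context,
     and one factor changes at a time. *)
  have := uu' x (v • y); have := vv' (x • u') y.
  by rewrite !dm_mulA => vle ule; apply: le_trans ule vle.
Qed.

Lemma quot_dmonoid_map_generated (D : variety) (M : dmonoid D)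
    (R : M -> M -> Prop) (cR : is_dmonoid_congruence R) :
  is_generated (quot_dmonoid_map cR).
Proof.
split=> [|a]; last by have [u ->] := @quot_projS _ _ _ cR a; exists u.
split=> // [|u v]; first exact: quot_map_morphism.
exact: esym (quot_projM cR u v).
Qed.

Lemma syntactic_le_recognizes (D : variety) (XS M : dmonoid D) (Y : object D)
    (L : XS -> Y) (e : XS -> M) :
  is_dmonoid_morphism e -> recognizes e L ->
  forall u v, e u <= e v -> syntactic_le L u v.
Proof.
move=> [_ _ eM] [f [[fmono _] ->]] u v uv x y /=.
by rewrite !eM; apply: fmono; apply: (mul_context_morphism (e x) (e y)).1.
Qed.

Lemma quot_syntactic_le_syntactic (D : variety) (XS : dmonoid D) (Y : object D)
    (L : XS -> Y) (cL : is_dmonoid_congruence (syntactic_le L)) :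
  is_morphism L -> is_syntactic L (quot_dmonoid_map cL).
Proof.
move=> mL; have qg := quot_dmonoid_map_generated cL.
have [[mq _ _] qs] := qg.
split=> // [|M e ge re].
- apply: (homomorphism_factor mq qs mL) => u v /quot_mapP.
  by move=> /(_ (dm_one XS) (dm_one XS)); rewrite !dm_mul1m !dm_mulm1.
- apply: dmonoid_homomorphism_factor => //; first by case: qg.
  by move=> u v uv; apply/quot_mapP/(syntactic_le_recognizes ge.1 re).
Qed.

Theorem theorem3p17 (D : variety) (hD : commutative_variety D)
    (X Y : object D)
    (XS : dmonoid D) (eta : X -> XS) (hXS : is_free_dmonoid eta)
    (L : XS -> Y) (hL : is_morphism L) :
  exists cL : is_dmonoid_congruence (syntactic_le L),
    is_syntactic L (quot_dmonoid_map cL) /\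
    (forall (M : dmonoid D) (e : XS -> M), is_syntactic L e ->
       generated_iso (quot_dmonoid_map cL) e).
Proof.
(* The quotient monoid depends on the proof of congruence, so that proof is the witness. *)
exists (syntactic_le_congruence hL).
have sL := quot_syntactic_le_syntactic (syntactic_le_congruence hL) hL.
by split=> // M e; apply: syntactic_unique.
Qed.
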